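(* Let $\widehat{A}$ be a noetherian commutative ring which is $\widehat{\mathfrak{a}}$-adically complete with respect to some ideal $\widehat{\mathfrak{a}}$. Let $Z$ be any set. Then: (1) For any $i \geq 0$ the canonical homomorphism $$A_i \otimes_{\widehat{A}} \operatorname{F}_{\mathrm{dec}}(Z, \widehat{A}) \to \operatorname{F}_{\mathrm{fin}}(Z, A_i)$$ is bijective, where $A_i := \widehat{A}/\widehat{\mathfrak{a}}^{\,i+1}$. (2) The $\widehat{A}$-module $\operatorname{F}_{\mathrm{dec}}(Z, \widehat{A})$ is flat and $\widehat{\mathfrak{a}}$-adically complete.
   Context: An $\widehat{A}$-module $N$ is $\widehat{\mathfrak{a}}$-adically complete if the canonical homomorphism $N \to \varprojlim_i (N/\widehat{\mathfrak{a}}^{\,i+1}N)$ is bijective. For $a \in \widehat{A}$ put $\operatorname{ord}(a) := \sup\{ i \in \mathbb{N} \mid a \in \widehat{\mathfrak{a}}^{\,i} \} \in \mathbb{N}\cup\{\infty\}$. A function $f : Z \to \widehat{A}$ is decaying if for every $i \in \mathbb{N}$ the set $\{ z \in Z \mid \operatorname{ord}(f(z)) \leq i\}$ is finite; $\operatorname{F}_{\mathrm{dec}}(Z, \widehat{A})$ is the $\widehat{A}$-module (pointwise operations) of decaying functions $Z \to \widehat{A}$. $\operatorname{F}_{\mathrm{fin}}(Z, A_i)$ is the module of finite-support functions $Z \to A_i$. The canonical homomorphism in (1) sends $a \otimes f$ to the function $z \mapsto a \cdot \overline{f(z)}$, where $\overline{f(z)}$ is the image of $f(z)$ in $A_i$.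 *)

(* Defs.v *)
From HB Require Import structures.
From mathcomp Require Import all_boot all_order all_algebra.
From mathcomp Require Import finmap all_classical.
From mathcomp Require Import constructive_ereal.

Set Implicit Arguments.
Unset Strict Implicit.
Unset Printing Implicit Defensive.

Import Order.TTheory GRing.Theory Num.Theory.
Local Open Scope classical_set_scope.
Local Open Scope quotient_scope.
Local Open Scope ring_scope.

(* [comPzRingType] rather than [comNzRingType]: the zero ring is allowed, and
   it is the only ring complete with respect to its unit ideal. An ideal of [A]
   is a submodule of [A^o]; it need not be proper. *)

Section Submodules.
Variables (A : comPzRingType) (M : lmodType A).

Definition spanned (S : set M) : {pred M} :=
  [pred x | x \in smallest (fun T : set M => submod_closed (mem T)) S].

Lemma spanned_closed S : subsemimod_closed (spanned S).
Proof.
apply: GRing.submod_closed_semi; split.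
  by apply/mem_set => T [[T0 _] _]; exact/set_mem.
move=> a u v /set_mem uS /set_mem vS; apply/mem_set => T [[T0 Tlin] ST].
by apply/set_mem/Tlin; apply/mem_set; [exact: uS|exact: vS].
Qed.

HB.instance Definition _ S :=
  GRing.isSubmodClosed.Build A M (spanned S) (spanned_closed S).

Definition span (S : set M) : submodClosed M := spanned S.

Lemma mem_span (S : set M) x : S x -> x \in span S.
Proof. by move=> Sx; apply/mem_set => T [_]; exact. Qed.

Lemma span_sub (S : set M) (N : submodClosed M) :
  (forall x, S x -> x \in N) -> forall x, x \in span S -> x \in N.
Proof.
move=> SN x /set_mem xS; apply: (xS [set` N]); split => //.
have memN y : (y \in mem [set` N]) = (y \in N) by apply/idP/idP=> [/set_mem|yN]; last exact/mem_set.
split; first by rewrite memN rpred0.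
by move=> a u v; rewrite !memN => uN vN; rewrite rpredD ?rpredZ.
Qed.

Definition full_submod : submodClosed M := span setT.

Definition ideal_act (J : submodClosed A^o) (N : submodClosed M) :
  submodClosed M := span [set a *: x | a in [set` J] & x in [set` N]].

End Submodules.

Arguments full_submod {A} M.

Section Ideals.
Variables (A : comPzRingType) (I : submodClosed A^o).

Fixpoint ideal_pow (n : nat) : submodClosed A^o :=
  if n is m.+1 then ideal_act I (ideal_pow m) else full_submod A^o.

Lemma ideal_powS n x : x \in ideal_pow n.+1 -> x \in ideal_pow n.
Proof.
by apply: span_sub => _ [a _ [y yN <-]]; exact: rpredZ.
Qed.

Lemma ideal_pow_le m n x : (m <= n)%N ->
  x \in ideal_pow n -> x \in ideal_pow m.
Proof.
move=> /subnK <-; elim: (n - m)%N => // k IH /ideal_powS; exact: IH.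
Qed.

End Ideals.

Definition noetherian (A : comPzRingType) : Prop :=
  forall J : submodClosed A^o, exists s : seq A, J =i span (M := A^o) [set` s].

Section Quotients.
Variables (A : comPzRingType) (M : lmodType A) (N : submodClosed M).

(* [submodClosed] does not inherit from [zmodClosed] in the library. *)
Definition zmod_of_submod : {pred M} := N.

HB.instance Definition _ := GRing.isZmodClosed.Build M zmod_of_submod
  (GRing.submod_closedB (submodClosedP N)).

Definition quotmod : Type := Quotient.quot zmod_of_submod.

HB.instance Definition _ := GRing.Zmodule.on quotmod.
HB.instance Definition _ := EqQuotient.on quotmod.

Definition qpi (x : M) : quotmod := \pi_(Quotient.quot zmod_of_submod) x.

Definition qscale (a : A) (q : quotmod) : quotmod := qpi (a *: repr q).

Lemma qpi_eq x y : (qpi x = qpi y) <-> (x - y \in N).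
Proof.
have -> : (x - y \in N) = (qpi x == qpi y) by
  exact: (@Quotient.idealrBE M zmod_of_submod x y).
by split=> /eqP.
Qed.

Lemma qpi_repr q : qpi (repr q) = q.
Proof. exact: reprK. Qed.

Lemma repr_qpi x : repr (qpi x) - x \in N.
Proof. by apply/qpi_eq; rewrite qpi_repr. Qed.

Lemma qpiD x y : qpi (x + y) = qpi x + qpi y.
Proof. exact: (raddfD (GRing.Additive.clone M _ \pi_(Quotient.quot zmod_of_submod) _)). Qed.

Lemma qscale_qpi a x : qscale a (qpi x) = qpi (a *: x).
Proof. by apply/qpi_eq; rewrite -scalerBr rpredZ ?repr_qpi. Qed.

Lemma qscaleA a b q : qscale a (qscale b q) = qscale (a * b) q.
Proof. by rewrite -(qpi_repr q) !qscale_qpi scalerA. Qed.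

Lemma qscale1 : left_id 1 qscale.
Proof. by move=> q; rewrite /qscale scale1r qpi_repr. Qed.

Lemma qscaleDr : right_distributive qscale +%R.
Proof.
by move=> a p q; rewrite -(qpi_repr p) -(qpi_repr q) -qpiD !qscale_qpi scalerDr qpiD.
Qed.

Lemma qscaleDl q : {morph qscale^~ q : a b / a + b}.
Proof. by move=> a b; rewrite /qscale scalerDl qpiD. Qed.

HB.instance Definition _ := GRing.Zmodule_isLmodule.Build A quotmod
  qscaleA qscale1 qscaleDr qscaleDl.

Lemma qpiZ a x : qpi (a *: x) = a *: qpi x.
Proof. by rewrite -qscale_qpi. Qed.

Lemma qpi_is_linear : linear qpi.
Proof. by move=> a x y; rewrite qpiD qpiZ. Qed.

HB.instance Definition _ := GRing.isLinear.Build A M quotmod *:%R qpi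
  qpi_is_linear.

End Quotients.

Arguments qpi {A M} N x.

Section QuotientRing.
Variables (A : comPzRingType) (J : submodClosed A^o).

Definition quotring : Type := quotmod J.

HB.instance Definition _ := GRing.Lmodule.on quotring.

Definition rpi (a : A) : quotring := qpi J a.

Definition qone : quotring := rpi 1.
Definition qmul (p q : quotring) : quotring := rpi (repr p * repr q).

Lemma rpi_eq a b : (rpi a = rpi b) <-> ((a - b : A^o) \in J).
Proof. exact: qpi_eq. Qed.

Lemma rpi_repr (q : quotring) : rpi (repr q) = q.
Proof. exact: reprK. Qed.

Lemma rpiD a b : rpi (a + b) = rpi a + rpi b.
Proof. exact: (@qpiD _ A^o). Qed.

Lemma qmul_rpi a b : qmul (rpi a) (rpi b) = rpi (a * b).
Proof.
have idl (c d : A) : (d : A^o) \in J -> (c * d : A^o) \in J.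
  by move=> dJ; exact: (rpredZ c dJ).
apply/rpi_eq; rewrite -[_ * _](subrK (repr (rpi a) * b)) -addrA.
rewrite -mulrBr -mulrBl; apply: rpredD; first exact/idl/(@repr_qpi _ A^o).
by rewrite mulrC; exact/idl/(@repr_qpi _ A^o).
Qed.

Lemma qmulA : associative qmul.
Proof.
by move=> p q r; rewrite -(rpi_repr p) -(rpi_repr q) -(rpi_repr r) !qmul_rpi mulrA.
Qed.

Lemma qmulC : commutative qmul.
Proof. by move=> p q; rewrite /qmul mulrC. Qed.

Lemma qmul1 : left_id qone qmul.
Proof. by move=> q; rewrite -(rpi_repr q) qmul_rpi mul1r. Qed.

Lemma qmulDl : left_distributive qmul +%R.
Proof.
move=> p q r; rewrite -(rpi_repr p) -(rpi_repr q) -(rpi_repr r).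
by rewrite -rpiD !qmul_rpi mulrDl rpiD.
Qed.

HB.instance Definition _ := GRing.Zmodule_isComPzRing.Build quotring
  qmulA qmulC qmul1 qmulDl.

Lemma rpiM a b : rpi (a * b) = rpi a * rpi b.
Proof. by rewrite -qmul_rpi. Qed.

Lemma rpiZ (a : A) (q : quotring) : a *: q = rpi a * q.
Proof. by rewrite -(rpi_repr q) -rpiM; exact: (@qscale_qpi _ A^o). Qed.

Lemma quot_scalerAl (a : A) (p q : quotring) : a *: (p * q) = (a *: p) * q.
Proof. by rewrite !rpiZ mulrA. Qed.

End QuotientRing.

Section Completeness.
Variables (A : comPzRingType) (I : submodClosed A^o) (M : lmodType A).

Definition adic_quot (i : nat) : Type :=
  quotmod (ideal_act (ideal_pow I i.+1) (full_submod M)).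

Definition adic_pi (i : nat) (x : M) : adic_quot i :=
  qpi (ideal_act (ideal_pow I i.+1) (full_submod M)) x.

(* The transition map M / I^(j+1) M -> M / I^(i+1) M, for i <= j. *)
Definition adic_trans (i j : nat) (q : adic_quot j) : adic_quot i :=
  adic_pi i (repr (q : quotmod _)).

Definition adic_compat (q : forall i, adic_quot i) : Prop :=
  forall i j, (i <= j)%N -> adic_trans i (q j) = q i.

Definition adic_lim : Type := {q : forall i, adic_quot i | adic_compat q}.

Lemma adic_trans_pi i j x : (i <= j)%N ->
  adic_trans i (adic_pi j x) = adic_pi i x.
Proof.
move=> ij; apply/qpi_eq; have := repr_qpi (ideal_act (ideal_pow I j.+1) (full_submod M)) x.
apply: span_sub => _ [a aI [y yM <-]]; apply: mem_span.
by exists a; [apply: ideal_pow_le aI|exists y].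
Qed.

Definition to_adic_lim (x : M) : adic_lim :=
  exist adic_compat (fun i => adic_pi i x) (fun i j => @adic_trans_pi i j x).

Definition adically_complete : Prop := bijective to_adic_lim.

End Completeness.

Section FiniteSupport.
Variables (A : comPzRingType) (Z : Type) (V : lmodType A).

Definition fin_supported : {pred Z -> V} :=
  [pred f | `[< finite_set [set z | f z != 0] >]].

Lemma fin_supported_closed : subsemimod_closed fin_supported.
Proof.
apply: GRing.submod_closed_semi; split.
  apply/asboolP; rewrite (_ : [set _ | _] = set0) //.
  by apply/seteqP; split=> z //=; rewrite eqxx.
move=> a f g /asboolP ff /asboolP fg; apply/asboolP.
apply: sub_finite_set (_ : finite_set ([set z | f z != 0] `|` [set z | g z != 0])).
  move=> z /=; rewrite -[X in X != 0]/(a *: f z + g z).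
  by have [->|fz _] := eqVneq (f z) 0; [rewrite scaler0 add0r; right|left].
by rewrite finite_setU.
Qed.

HB.instance Definition _ :=
  GRing.isSubmodClosed.Build A (Z -> V) fin_supported fin_supported_closed.

Record Ffin : Type := MkFfin {
  ffin_val :> Z -> V;
  ffin_valP : ffin_val \in fin_supported }.

HB.instance Definition _ := [isSub for ffin_val].
HB.instance Definition _ := [Choice of Ffin by <:].
HB.instance Definition _ := [SubChoice_isSubLmodule of Ffin by <:].

End FiniteSupport.

Section Decaying.
Variables (A : comPzRingType) (I : submodClosed A^o).

(* N u {oo} sits inside [\bar int]. The set is never empty, because
   I^0 = A, so the default value of [supremum] plays no role. *)
Definition ord (a : A) : \bar int :=
  supremum 0%E [set (n%:Z)%:E | n in [set n | (a : A^o) \in ideal_pow I n]].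

Lemma ord_le (a : A) (i : nat) :
  (ord a <= (i%:Z)%:E)%E <-> (a : A^o) \notin ideal_pow I i.+1.
Proof.
set S := [set (n%:Z)%:E | n in [set n | (a : A^o) \in ideal_pow I n]].
have S0 : S 0%E by exists 0 => //; exact: mem_span.
have supS : supremums S !=set0.
  have [aI|/existsNP[k ak]] := pselect (forall n, (a : A^o) \in ideal_pow I n).
    exists +oo%E; split=> [x _|x ubx]; first exact: leey.
    case: x ubx => [m| |] ubx //; last by have := ubx _ S0.
    have : ((`|m|%N.+1%:Z)%:E <= m%:E :> \bar int)%E.
      by apply: ubx; exists `|m|%N.+1 => //; exact: aI.
    by rewrite lee_fin -addn1 PoszD abszE leNgt ltzD1 ler_norm.
  have exk : exists k, (a : A^o) \notin ideal_pow I k by exists k; apply/negP.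
  case: (ex_minnP exk) => -[|m] am min_m; first by rewrite mem_span in am.
  have aIm : (a : A^o) \in ideal_pow I m.
    by apply: contraT => /min_m; rewrite ltnn.
  exists (m%:Z)%:E; split=> [_ [n /= aIn <-]|x]; last by apply; exists m.
  rewrite lee_fin lez_nat leqNgt; apply: contra am => mn.
  exact: ideal_pow_le aIn.
split=> [le_i|aNI].
  apply/negP => aI; have : ((i.+1%:Z)%:E <= ord a)%E.
    by apply: ge_supremum_Nmem => //; exists i.+1.
  by move=> /le_trans/(_ le_i); rewrite lee_fin lez_nat ltnn.
rewrite /ord /supremum -/S ifF; last by apply/eqP=> S_0; rewrite S_0 in S0.
case: xgetP => [x _ [_ lbx]|]; last by case: supS => x Sx /(_ x).
apply: lbx => _ [n /= aIn <-]; rewrite lee_fin lez_nat leqNgt.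
by apply: contra aNI => lt_in; exact: ideal_pow_le aIn.
Qed.

Variable Z : Type.

Definition decaying : {pred Z -> A^o} :=
  [pred f | `[< forall i : nat, finite_set [set z | (ord (f z) <= (i%:Z)%:E)%E] >]].

Lemma decaying_closed : subsemimod_closed decaying.
Proof.
apply: GRing.submod_closed_semi; split.
  apply/asboolP => i; rewrite (_ : [set _ | _] = set0) //.
  by apply/seteqP; split=> z //= /ord_le; rewrite -[X in X \notin _]/0 rpred0.
move=> a f g /asboolP df /asboolP dg; apply/asboolP => i.
apply: sub_finite_set (_ : finite_set ([set z | (ord (f z) <= (i%:Z)%:E)%E]
    `|` [set z | (ord (g z) <= (i%:Z)%:E)%E])); last by rewrite finite_setU.
move=> z /= /ord_le; rewrite -[X in X \notin _]/(a *: f z + g z) => fgz.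
have [fz|fz] := boolP (f z \in ideal_pow I i.+1); last by left; apply/ord_le.
right; apply/ord_le; apply: contra fgz => gz; exact: rpredD (rpredZ _ fz) gz.
Qed.

HB.instance Definition _ :=
  GRing.isSubmodClosed.Build A (Z -> A^o) decaying decaying_closed.

Record Fdec : Type := MkFdec {
  fdec_val :> Z -> A^o;
  fdec_valP : fdec_val \in decaying }.

HB.instance Definition _ := [isSub for fdec_val].
HB.instance Definition _ := [Choice of Fdec by <:].
HB.instance Definition _ := [SubChoice_isSubLmodule of Fdec by <:].

End Decaying.

Section Tensor.
Variables (A : comPzRingType) (M N : lmodType A).

(* The free module with basis M * N. *)
Definition tfree : Type := Ffin (M * N) A^o.
HB.instance Definition _ := GRing.Lmodule.on tfree.

Lemma tbasis_subproof (m : M) (n : N) :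
  (fun x : M * N => (x == (m, n))%:R : A^o) \in @fin_supported A (M * N) A^o.
Proof.
apply/asboolP; apply: sub_finite_set (finite_set1 (m, n)) => x /=.
by have [->|_] := eqVneq x (m, n); rewrite ?eqxx.
Qed.

Definition tbasis (m : M) (n : N) : tfree := MkFfin (tbasis_subproof m n).

Inductive trelator : tfree -> Prop :=
| trelDl m1 m2 n : trelator (tbasis (m1 + m2) n - (tbasis m1 n + tbasis m2 n))
| trelDr m n1 n2 : trelator (tbasis m (n1 + n2) - (tbasis m n1 + tbasis m n2))
| trelZl (a : A) m n : trelator (tbasis (a *: m) n - a *: tbasis m n)
| trelZr (a : A) m n : trelator (tbasis m (a *: n) - a *: tbasis m n).

Definition tensor : Type := quotmod (span trelator).
HB.instance Definition _ := GRing.Lmodule.on tensor.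

Definition tpure (m : M) (n : N) : tensor := qpi (span trelator) (tbasis m n).

Lemma tpureDl m1 m2 n : tpure (m1 + m2) n = tpure m1 n + tpure m2 n.
Proof.
by rewrite /tpure -qpiD; apply/qpi_eq; apply: mem_span; exact: trelDl.
Qed.

Lemma tpureDr m n1 n2 : tpure m (n1 + n2) = tpure m n1 + tpure m n2.
Proof.
by rewrite /tpure -qpiD; apply/qpi_eq; apply: mem_span; exact: trelDr.
Qed.

Lemma tpureZl (a : A) m n : tpure (a *: m) n = a *: tpure m n.
Proof.
by rewrite /tpure -qpiZ; apply/qpi_eq; apply: mem_span; exact: trelZl.
Qed.

Lemma tpureZr (a : A) m n : tpure m (a *: n) = a *: tpure m n.
Proof.
by rewrite /tpure -qpiZ; apply/qpi_eq; apply: mem_span; exact: trelZr.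
Qed.

Section Lift.
Variables (P : lmodType A) (b : M -> N -> P).

Definition is_bilinear : Prop :=
  (forall n, linear (b^~ n)) /\ (forall m, linear (b m)).

Definition free_lift (f : tfree) : P := \sum_(x \in setT) f x *: b x.1 x.2.

(* Independent of the representative only when [b] is bilinear: it is then the
   linear map such that [m (x) n |-> b m n]. *)
Definition tensor_lift (t : tensor) : P := free_lift (repr (t : quotmod _)).

Lemma free_liftE (D : set (M * N)) (f : tfree) : finite_set D ->
  (forall x, f x != 0 -> D x) ->
  free_lift f = \sum_(x <- fset_set D) f x *: b x.1 x.2.
Proof.
move=> finD fD; rewrite /free_lift -fsbig_finite//; symmetry.
apply: fsbig_widen => // x [_ /= Dx]; have [->|/fD//] := eqVneq (f x) 0.
exact: scale0r.
Qed.

Lemma free_lift_is_linear : linear free_lift.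
Proof.
move=> a f g; set D := [set x | f x != 0] `|` [set x | g x != 0].
have finD : finite_set D.
  by rewrite finite_setU; split; [have /asboolP := ffin_valP f|have /asboolP := ffin_valP g].
have fgD x : (a *: f + g) x != 0 -> D x.
  rewrite /D /= -[X in X != 0]/(a * f x + g x).
  by have [->|fx _] := eqVneq (f x) 0; [rewrite mulr0 add0r; right|left].
have fD x : f x != 0 -> D x by left.
have gD x : g x != 0 -> D x by right.
rewrite (free_liftE finD fgD) (free_liftE finD fD) (free_liftE finD gD).
rewrite scaler_sumr -big_split /=; apply: eq_bigr => x _.
by rewrite -[LHS]/((a * f x + g x) *: _) scalerDl scalerA.
Qed.

HB.instance Definition _ := GRing.isLinear.Build A tfree P *:%R free_lift
  free_lift_is_linear.

Lemma free_lift_basis m n : free_lift (tbasis m n) = b m n.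
Proof.
rewrite (@free_liftE [set (m, n)]) //.
  by rewrite fset_set1 big_seq_fset1 /= eqxx scale1r.
by move=> x /=; have [->|_] := eqVneq x (m, n); rewrite ?eqxx.
Qed.

Hypothesis bil : is_bilinear.

Lemma free_lift_rel f : f \in span trelator -> free_lift f = 0.
Proof.
case: bil => bl br /set_mem fS; apply: (fS [set f | free_lift f = 0]); split.
  split; first exact/mem_set/linear0.
  move=> a u v /set_mem/= u0 /set_mem/= v0; apply/mem_set => /=.
  by rewrite free_lift_is_linear u0 v0 scaler0 addr0.
have bDl m1 m2 n : b (m1 + m2) n = b m1 n + b m2 n.
  by have := bl n 1 m1 m2; rewrite !scale1r.
have bDr m n1 n2 : b m (n1 + n2) = b m n1 + b m n2.
  by have := br m 1 n1 n2; rewrite !scale1r.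
have b0l n : b 0 n = 0 by apply: (addrI (b 0 n)); rewrite -bDl !addr0.
have b0r m : b m 0 = 0 by apply: (addrI (b m 0)); rewrite -bDr !addr0.
move=> _ [m1 m2 n|m n1 n2|a m n|a m n] /=;
  rewrite linearB ?linearD ?linearZ /= !free_lift_basis ?scalerN -?opprD.
- by apply/eqP; rewrite subr_eq0 bDl.
- by apply/eqP; rewrite subr_eq0 bDr.
- by apply/eqP; rewrite subr_eq0; have := bl n a m 0; rewrite b0l !addr0 => ->.
- by apply/eqP; rewrite subr_eq0; have := br m a n 0; rewrite b0r !addr0 => ->.
Qed.

Lemma tensor_lift_qpi f : tensor_lift (qpi (span trelator) f) = free_lift f.
Proof.
apply/eqP; rewrite -subr_eq0 /tensor_lift -linearB; apply/eqP.
exact/free_lift_rel/repr_qpi.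
Qed.

Lemma tensor_lift_pure m n : tensor_lift (tpure m n) = b m n.
Proof. by rewrite tensor_lift_qpi free_lift_basis. Qed.

Lemma tensor_lift_is_linear : linear tensor_lift.
Proof.
move=> a s t; rewrite -[s](@qpi_repr _ _ (span trelator)).
rewrite -[t](@qpi_repr _ _ (span trelator)).
rewrite -[a *: _ + _]/(a *: qpi _ _ + qpi _ _) -qpiZ -qpiD !tensor_lift_qpi.
exact: linearP.
Qed.

End Lift.
End Tensor.

Section Flatness.
Variables (A : comPzRingType) (M : lmodType A).

Lemma tensor_mapr_bilinear (N1 N2 : lmodType A) (g : {linear N1 -> N2}) :
  is_bilinear (fun (m : M) (n : N1) => tpure m (g n)).
Proof.
split=> [n a x y|m a x y]; first by rewrite tpureDl tpureZl.
by rewrite linearP tpureDr tpureZr.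
Qed.

Definition tensor_mapr (N1 N2 : lmodType A) (g : {linear N1 -> N2}) :
    tensor M N1 -> tensor M N2 :=
  tensor_lift (fun m n => tpure m (g n)).

HB.instance Definition _ (N1 N2 : lmodType A) (g : {linear N1 -> N2}) :=
  GRing.isLinear.Build A (tensor M N1) (tensor M N2) *:%R (tensor_mapr g)
    (tensor_lift_is_linear (tensor_mapr_bilinear g)).

Definition flat : Prop :=
  forall (N1 N2 : lmodType A) (g : {linear N1 -> N2}),
    injective g -> injective (tensor_mapr g).

End Flatness.

Section CanonicalMap.
Variables (A : comPzRingType) (I : submodClosed A^o) (Z : Type) (i : nat).

Definition adic_ring : Type := quotring (ideal_pow I i.+1).
HB.instance Definition _ := GRing.Lmodule.on adic_ring.
HB.instance Definition _ := GRing.ComPzRing.on adic_ring.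

Lemma dec_to_fin_subproof (a : adic_ring) (f : Fdec I Z) :
  (fun z => a * (rpi (ideal_pow I i.+1) (f z) : adic_ring)) \in
    @fin_supported A Z adic_ring.
Proof.
have /asboolP/(_ i) fi := fdec_valP f; apply/asboolP.
apply: sub_finite_set fi => z /=; apply: contra_neqP => fz.
have fI : f z \in ideal_pow I i.+1 by apply: contra_notT fz => /ord_le.
rewrite (_ : rpi _ _ = 0) ?mulr0 //.
by rewrite -[RHS](linear0 (qpi (ideal_pow I i.+1))); apply/qpi_eq; rewrite subr0.
Qed.

Definition dec_to_fin_bil (a : adic_ring) (f : Fdec I Z) : Ffin Z adic_ring :=
  MkFfin (dec_to_fin_subproof a f).

Definition dec_to_fin : tensor adic_ring (Fdec I Z) -> Ffin Z adic_ring :=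
  tensor_lift dec_to_fin_bil.

Lemma dec_to_fin_bilinear : is_bilinear dec_to_fin_bil.
Proof.
split=> [f r a b|a r f g]; apply/val_inj/funext => z.
  rewrite -[LHS]/((r *: a + b) * _) mulrDl.
  by congr (_ + _); rewrite -quot_scalerAl.
rewrite -[LHS]/(a * rpi _ (r * f z + g z)) rpiD rpiM mulrDr mulrCA.
by congr (_ + _); rewrite -rpiZ.
Qed.

HB.instance Definition _ := GRing.isLinear.Build A
  (tensor adic_ring (Fdec I Z)) (Ffin Z adic_ring) *:%R dec_to_fin
  (tensor_lift_is_linear dec_to_fin_bilinear).

Lemma dec_to_fin_pure (a : adic_ring) (f : Fdec I Z) (z : Z) :
  dec_to_fin (tpure a f) z = a * rpi (ideal_pow I i.+1) (f z).
Proof. by rewrite /dec_to_fin (tensor_lift_pure dec_to_fin_bilinear). Qed.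

End CanonicalMap.

(* Main.v *)
Require Import Defs.
From HB Require Import structures.
From mathcomp Require Import all_boot all_order all_algebra.
From mathcomp Require Import finmap all_classical.
From mathcomp Require Import constructive_ereal.

(** Write [F] for the module of decaying functions, and [ev_M] for the evaluation
    map from the tensor product of [F] and [M] to [Z -> M], which sends the class
    of [(f, m)] to [fun z => f z *: m]. Everything follows from the injectivity of
    [ev_M] for every module [M] ([bilinear_fdec_eq0]).

    - Flatness: [ev] is natural in [M], and [Z -> -] preserves injections.
    - [dec_to_fin] is, up to the order of the factors, [ev_M] for
      [M = A / I^(i+1)], with target cut down to finitely supported functions; it
      is onto because a finitely supported function lifts to a finitely
      supported, hence decaying, one.

    Let [\sum_j f_j (x) m_j] be in the kernel of [ev_M], with [j < r]. The
    relations between the [m_j] form a submodule [K] of [A^r], and all the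
    vectors [(f_j z)_j] belong to [K]. By [fdec_factor], [(f_j)_j] is a finite sum
    of terms [g_l *: b_l] with [g_l] in [F] and [b_l] in [K]. As the [b_l] are
    relations, the tensor is zero.

    In [fdec_factor], the [b_l] are generators of [K], finitely many because [A^r]
    is noetherian ([fg_of_noetherian]), and what has to be shown is that the
    coefficients of a vector of [K] can be chosen to tend to [0] with the vector.
    That is the Artin-Rees lemma, in the weak form that the adic topology of [K]
    is induced by the one of [A^r] ([artin_rees]). Its proof needs no Rees
    algebra: a submodule [L] of [A^r] that is maximal among those containing
    [I^n K] and meeting [K] inside [I^n K] must contain some [I^N A^r].

    The case [r = 1], [K = I^n] of [fdec_factor] says that [I^n F] consists of the
    decaying functions with values in [I^n] ([mem_ideal_act_fdec]). The adic
    topology of [F] is therefore that of uniform convergence, and completeness of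
    [F] follows from completeness of [A] by taking pointwise limits. *)

Set Implicit Arguments.
Unset Strict Implicit.
Unset Printing Implicit Defensive.

Import GRing.Theory.
Local Open Scope classical_set_scope.
Local Open Scope ring_scope.

Local Notation span := Defs.span.

(** * Bare functions satisfying [linear] *)

Section BareLinear.
Variables (A : comPzRingType) (U V : lmodType A) (h : U -> V).
Hypothesis hlin : linear h.

Lemma linear_fun_sum n (u : 'I_n -> U) : h (\sum_l u l) = \sum_l h (u l).
Proof.
pose hL : {linear U -> V} := HB.pack h (GRing.isLinear.Build A U V *:%R h hlin).
exact: (linear_sum hL).
Qed.

Lemma linear_fun0 : h 0 = 0.
Proof. by have := linear_fun_sum (fun _ : 'I_0 => 0); rewrite !big_ord0. Qed.

Lemma linear_fun_comb n (c : 'I_n -> A) (u : 'I_n -> U) :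
  h (\sum_l c l *: u l) = \sum_l c l *: h (u l).
Proof.
rewrite linear_fun_sum; apply: eq_bigr => l _.
by rewrite -[c l *: u l]addr0 hlin linear_fun0 addr0.
Qed.

End BareLinear.

(** * Submodules and finite generation *)

Section Generation.
Variables (A : comPzRingType) (M : lmodType A).
Implicit Types (N K L T : submodClosed M).

Lemma span_ind (S P : set M) : P 0 ->
  (forall a u v, P u -> P v -> P (a *: u + v)) ->
  (forall x, S x -> P x) -> forall x, x \in span S -> P x.
Proof.
move=> P0 Plin SP x /set_mem xS; apply: (xS P); split => //.
split=> [|a u v /set_mem uP /set_mem vP]; first exact/mem_set.
by apply/mem_set; exact: Plin.
Qed.

(** Lets a predicate closed under linear combinations be used as a submodule,
    without declaring an instance for it. *)
Lemma mem_span_closed (P : set M) : P 0 ->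
  (forall a u v, P u -> P v -> P (a *: u + v)) ->
  forall x, x \in span P <-> P x.
Proof.
by move=> P0 Plin x; split=> [|Px]; [exact: span_ind|exact: mem_span].
Qed.

Lemma submod_lin N a u v : u \in N -> v \in N -> a *: u + v \in N.
Proof. by move=> uN vN; rewrite rpredD ?rpredZ. Qed.

Lemma submod_subr N u v : u \in N -> v \in N -> u - v \in N.
Proof. by move=> uN vN; rewrite addrC -scaleN1r submod_lin. Qed.

Lemma span_mono (S1 S2 : set M) : (forall x, S1 x -> S2 x) ->
  forall x, x \in span S1 -> x \in span S2.
Proof. by move=> S12; apply: span_sub => x /S12; exact: mem_span. Qed.

Lemma mem_span_seq (s : seq M) x : x \in span [set` s] ->
  exists c : 'I_(size s) -> A, x = \sum_i c i *: s`_i.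
Proof.
move: x; apply: span_ind => [|a u v [c ->] [d ->]|x /= xs].
- by exists (fun=> 0); rewrite big1 // => i _; rewrite scale0r.
- exists (fun i => a * c i + d i); rewrite scaler_sumr -big_split /=.
  by apply: eq_bigr => i _; rewrite scalerDl scalerA.
have xs' : (index x s < size s)%N by rewrite index_mem.
exists (fun i => (i == Ordinal xs')%:R).
rewrite (bigD1 (Ordinal xs')) //= eqxx scale1r nth_index // big1 ?addr0 //.
by move=> i /negbTE ->; rewrite scale0r.
Qed.

Lemma span_cons m (s : seq M) x : x \in span [set` m :: s] ->
  exists a, exists2 y, y \in span [set` s] & x = a *: m + y.
Proof.
move: x; apply: span_ind => [|a u v [b [y ys ->]] [c [z zs ->]]|x].
- by exists 0, 0; rewrite ?rpred0 // scale0r addr0.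
- exists (a * b + c), (a *: y + z); first exact: submod_lin.
  by rewrite scalerDr scalerDl scalerA addrACA.
rewrite /= inE => /orP[/eqP ->|xs].
  by exists 1, 0; rewrite ?rpred0 // scale1r addr0.
by exists 0, x; [exact: mem_span|rewrite scale0r add0r].
Qed.

End Generation.

Section Noetherian.
Variables (A : comPzRingType) (M : lmodType A).
Implicit Types (N K L T : submodClosed M).

Definition finitely_generated N := exists s : seq M, N =i span [set` s].

Definition noetherian_module := forall N, finitely_generated N.

(** Hilbert's argument, one generator [m] at a time: a submodule of [Am + M']
    is controlled by its intersection with [M'] and by the ideal of the
    coefficients that [m] takes in it. *)
Lemma fg_of_noetherian (s : seq M) N : noetherian A ->
  (forall x, x \in N -> x \in span [set` s]) -> finitely_generated N.
Proof.
move=> noethA; elim: s N => [|m s IH] N Ns.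
  exists [::] => x; apply/idP/idP => [/Ns //|].
  by apply: span_sub.
pose lifts a y := y \in span [set` s] /\ a *: m + y \in N.
pose J : set A^o := [set a | exists y, lifts a y].
have memJ (a : A^o) : a \in span J <-> J a.
  apply: (mem_span_closed (M := A^o) (P := J)) => [|b u v [y [ys yN]] [z [zs zN]]].
    by exists 0; split; rewrite ?scale0r ?addr0 rpred0.
  exists (b *: y + z); split; first exact: submod_lin.
  rewrite scalerDl -scalerA addrACA -scalerDr; exact: submod_lin.
have [sJ sJP] := noethA (span J).
have /choice[y yP] : forall a, exists y, J a -> lifts a y.
  move=> a; have [[y ay]|nJ] := pselect (J a); first by exists y.
  by exists 0.
pose P := [set x | x \in N /\ x \in span [set` s]].
have memP x : x \in span P <-> P x.
  apply: mem_span_closed => [|a u v [uN us] [vN vs]]; first by split; rewrite rpred0.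
  by split; exact: submod_lin.
have [t tP] := IH (span P) (fun x xP => proj2 ((memP x).1 xP)).
(* Lifts of generators of the ideal [J] of leading coefficients, followed by
   generators of the part of [N] that lies in the span of [s]. *)
pose r := [seq a *: m + y a | a <- sJ] ++ t.
have rN x : x \in span [set` r] -> x \in N.
  apply: span_sub => {}x; rewrite /= mem_cat => /orP[/mapP[a asJ ->]|xt].
    have : J a by apply/memJ; rewrite sJP; exact: mem_span.
    by move/yP => [].
  have : x \in span P by rewrite tP; exact: mem_span.
  by move/memP => [].
exists r => x; apply/idP/idP => [xN|]; last exact: rN.
have [a [z zs xE]] := span_cons (Ns _ xN).
have aJ : a \in span (M := A^o) [set` sJ].
  by rewrite -sJP; apply/memJ; exists z; split; rewrite -?xE.
pose D (b : A^o) := exists w, w \in span [set` r] /\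
  exists2 u, u \in span [set` s] & w = (b : A) *: m + u.
have [w [wr [u us wE]]] : D a.
  move: a aJ {xE}; apply: (span_ind (M := A^o) (P := D)) =>
    [|b c d [w [wr [u us wE]]] [w' [wr' [u' us' wE']]]|b bsJ].
  - exists 0; split; first exact: rpred0.
    by exists 0; rewrite ?rpred0 // scale0r addr0.
  - exists (b *: w + w'); split; first exact: submod_lin.
    exists (b *: u + u'); first exact: submod_lin.
    by rewrite wE wE' scalerDr [in RHS]scalerDl -scalerA addrACA.
  have br : b *: m + y b \in r by rewrite mem_cat (map_f (fun a : A => a *: m + y a)).
  exists (b *: m + y b); split; first exact: mem_span.
  have : J b by apply/memJ; rewrite sJP; exact: mem_span.
  by move/yP => [ys _]; exists (y b).
rewrite -(subrK w x) rpredD //.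
suff : x - w \in span [set` t].
  by apply: span_mono => v /= vt; rewrite mem_cat vt orbT.
rewrite -tP; apply/memP; split; first by apply: submod_subr => //; exact: rN.
by rewrite xE wE opprD addrACA subrr add0r submod_subr.
Qed.

Lemma noetherian_chain (N : nat -> submodClosed M) : noetherian_module ->
  (forall k x, x \in N k -> x \in N k.+1) ->
  exists k, forall l x, x \in N l -> x \in N k.
Proof.
move=> noethM incN.
have monoN k l x : (k <= l)%N -> x \in N k -> x \in N l.
  move=> /subnK <-; elim: (l - k)%N => // d IH /IH; rewrite addSn; exact: incN.
pose U : set M := [set x | exists k, x \in N k].
have memU x : x \in span U <-> U x.
  apply: mem_span_closed => [|a u v [k uk] [l vl]]; first by exists 0; rewrite rpred0.
  exists (maxn k l); apply: submod_lin.
    exact: monoN (leq_maxl _ _) uk.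
  exact: monoN (leq_maxr _ _) vl.
have [s sU] := noethM (span U).
have [k sk] : exists k, forall x, x \in s -> x \in N k.
  have {sU} : forall x, x \in s -> U x.
    by move=> x xs; apply/memU; rewrite sU; exact: mem_span.
  elim: s => [|x s IH] sU; first by exists 0.
  have [y ys|k sk] := IH; first by apply: sU; rewrite inE ys orbT.
  have [|l xl] := sU x; first exact: mem_head.
  exists (maxn k l) => y; rewrite inE => /orP[/eqP ->|/sk].
    exact: monoN (leq_maxr _ _) xl.
  exact/monoN/leq_maxl.
exists k => l x xl; have : x \in span U by apply/memU; exists l.
by rewrite sU; move: x {xl}; exact: span_sub.
Qed.

(** Zorn's lemma, applied to the sets [S] such that [span S + T] meets [K] inside
    [T]. Ordering generating sets rather than submodules makes the union of the
    empty chain admissible. *)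
Lemma maximal_meeting_within K T : exists L, [/\ forall x, x \in T -> x \in L,
  forall x, x \in L -> x \in K -> x \in T &
  forall L', (forall x, x \in L -> x \in L') ->
    (forall x, x \in L' -> x \in K -> x \in T) ->
    forall x, x \in L' -> x \in L].
Proof.
pose sp (S : set M) := span (S `|` [set` T])%classic.
have Tsp S x : x \in T -> x \in sp S by move=> xT; apply: mem_span; right.
pose P (S : set M) := forall x, x \in sp S -> x \in K -> x \in T.
have [F FP totF|S [PS maxS]] := @Zorn_bigcup _ P.
  suff spF x : x \in sp (\bigcup_(X in F) X)%classic ->
      x \in T \/ exists2 X, F X & x \in sp X.
    by move=> x /spF[//|[X /FP FX xX]]; exact: FX.
  move: x; apply: span_ind => [|a u v uF vF|x [[X FX xX]|xT]].
  - by left; rewrite rpred0.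
  - case: uF vF => [uT|[X FX uX]] [vT|[Y FY vY]].
    + by left; exact: submod_lin.
    + by right; exists Y => //; apply: submod_lin => //; exact: Tsp.
    + by right; exists X => //; apply: submod_lin => //; exact: Tsp.
    have spm (S1 S2 : set M) x : (S1 `<=` S2)%classic -> x \in sp S1 -> x \in sp S2.
      by move=> S12; apply: span_mono => {}x [/S12|]; [left|right].
    right; case: (totF X Y FX FY) => XY.
      by exists Y => //; apply: submod_lin => //; exact: spm uX.
    by exists X => //; apply: submod_lin => //; exact: spm vY.
  - by right; exists X => //; apply: mem_span; left.
  by left.
exists (sp S); split=> [x|//|L' LL' L'P x xL']; first exact: Tsp.
apply: contrapT => xL; apply: (maxS [set` L']); last first.
  move=> z zL'; apply: L'P; move: z zL'; apply: span_sub => y [//|/= yT].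
  exact/LL'/Tsp.
split=> [y Sy|L'S]; first by apply: LL'; apply: mem_span; left.
by apply: xL; apply: mem_span; left; exact: L'S.
Qed.

End Noetherian.

(** * Powers of an ideal and the Artin-Rees property *)

Section IdealPowers.
Variables (A : comPzRingType) (I : submodClosed A^o).
Implicit Type J : submodClosed A^o.

Lemma ideal_mull J (a b : A) : (b : A^o) \in J -> (a * b : A^o) \in J.
Proof. by move=> bJ; exact: (rpredZ a bJ). Qed.

Lemma exp_in_ideal_pow (a : A) n :
  (a : A^o) \in I -> (a ^+ n : A^o) \in ideal_pow I n.
Proof.
move=> aI; elim: n => [|n IH]; first exact: mem_span.
by rewrite exprS; apply: mem_span; exists a => //; exists (a ^+ n).
Qed.

Lemma ideal_act_full J (x : A^o) : x \in ideal_act J (full_submod A^o) <-> x \in J.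
Proof.
split=> [|xJ].
  move: x; apply: span_sub => _ [a aJ [b _ <-]].
  by rewrite -[_ *: _]/(a * b) mulrC; exact: ideal_mull.
apply: mem_span; exists x => //; exists 1; first exact: mem_span.
by rewrite -[LHS]/(x * 1) mulr1.
Qed.

(** The powers of [I] are defined as iterated products, so [I^n] is spanned by
    the products of [n] generators of [I]. *)
Lemma ideal_pow_gen_words (s : seq A) J n :
  (forall x, x \in I -> x \in span (M := A^o) [set` s]) ->
  (forall w : seq A, size w = n -> {subset w <= s} ->
     (\prod_(x <- w) x : A^o) \in J) ->
  forall x, x \in ideal_pow I n -> x \in J.
Proof.
move=> Is; elim: n J => [|n IH] J sJ x.
  have J1 : (1 : A^o) \in J by have := sJ [::]; rewrite big_nil; exact.
  by move=> _; rewrite -[x]mulr1; exact: ideal_mull.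
move: x; apply: span_sub => _ [a aI [y yI <-]].
pose Ja : set A^o := [set z : A^o | (a * z : A^o) \in J].
have memJa z : z \in span Ja <-> Ja z.
  apply: (mem_span_closed (M := A^o) (P := Ja)) => [|b u v uJ vJ].
    by rewrite /Ja /= mulr0 rpred0.
  rewrite /Ja /= -[b *: u + v]/(b * u + v) mulrDr mulrCA.
  by apply: rpredD => //; exact: ideal_mull.
apply/memJa; apply: (IH (span Ja)) yI => w sw ws; apply/memJa.
pose Jw : set A^o := [set z : A^o | (z * \prod_(x <- w) x : A^o) \in J].
suff : Jw a by [].
move: (Is _ aI); apply: (span_ind (M := A^o) (P := Jw)) => [|b u v uJ vJ|b bs].
- by rewrite /Jw /= mul0r rpred0.
- rewrite /Jw /= -[b *: u + v]/(b * u + v) mulrDl -mulrA.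
  by apply: rpredD => //; exact: ideal_mull.
rewrite /Jw /=; have := sJ (b :: w); rewrite big_cons; apply; first by rewrite /= sw.
by move=> c; rewrite inE => /orP[/eqP -> //|/ws].
Qed.

(** Pigeonhole: some letter of the word occurs at least [k] times. *)
Lemma long_word_in_ideal (s w : seq A) J k :
  (forall a, a \in s -> (a ^+ k : A^o) \in J) -> {subset w <= s} ->
  (k * size s < size w)%N -> (\prod_(x <- w) x : A^o) \in J.
Proof.
elim: s w => [|a s IH] w sJ ws; first by case: w ws => // b w /(_ b (mem_head _ _)).
move=> szw; rewrite (bigID (pred1 a)) /=.
have -> : \prod_(x <- w | x == a) x = a ^+ count_mem a w.
  rewrite (eq_bigr (fun=> a)) => [|x /eqP //].
  by rewrite big_const_seq iter_mulr_1.
have [kw|wk] := leqP k (count_mem a w).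
  rewrite -(subnK kw) exprD mulrAC; apply: ideal_mull.
  by apply: sJ; exact: mem_head.
rewrite -big_filter; apply: ideal_mull; apply: IH => [b bs|b|].
- by apply: sJ; rewrite inE bs orbT.
- by rewrite mem_filter => /andP[/negbTE ba /ws]; rewrite inE ba.
rewrite size_filter -(ltn_add2l (count_mem a w)) (count_predC (pred1 a) w).
by apply: leq_ltn_trans szw; rewrite mulnS leq_add2r ltnW.
Qed.

Lemma ideal_pow_sub (s : seq A) J k :
  I =i span (M := A^o) [set` s] -> (forall a, a \in s -> (a ^+ k : A^o) \in J) ->
  exists n, forall x, x \in ideal_pow I n -> x \in J.
Proof.
move=> Is sJ; exists (k * size s).+1.
apply: (@ideal_pow_gen_words s) => [x|w sw ws]; first by rewrite Is.
by apply: (long_word_in_ideal sJ ws); rewrite sw.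
Qed.

(** The qualitative Artin-Rees lemma: [K] inherits its adic topology from [M].
    Let [L] be maximal with [L :&: K] contained in [I^n K]. For [a] in [I], the
    chain of the [L : a^k] stabilizes at some [k]; then [L + a^k M] still meets
    [K] inside [I^n K], because [a^n] multiplies [K] into [L]. By maximality
    [a^k M] lies in [L], so [L] contains some [I^N M]. *)
Lemma artin_rees (M : lmodType A) (K : submodClosed M) (n : nat) :
  noetherian A -> noetherian_module M ->
  exists N, forall x, x \in K ->
    x \in ideal_act (ideal_pow I N) (full_submod M) ->
    x \in ideal_act (ideal_pow I n) K.
Proof.
move=> noethA noethM; set T := ideal_act (ideal_pow I n) K.
have [L [TL LKT maxL]] := maximal_meeting_within K T.
have powL (a : A) : (a : A^o) \in I -> exists k, forall y, a ^+ k *: y \in L.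
  move=> aI; pose Q k : set M := [set y | a ^+ k *: y \in L].
  have memQ k y : y \in span (Q k) <-> Q k y.
    apply: mem_span_closed => [|b u v uL vL]; first by rewrite /Q /= scaler0 rpred0.
    by rewrite /Q /= scalerDr scalerA mulrC -scalerA; exact: submod_lin.
  have [k kP] : exists k, forall l y, y \in span (Q l) -> y \in span (Q k).
    apply: noetherian_chain noethM _ => k y /memQ yL; apply/memQ.
    by rewrite /Q /= exprS -scalerA rpredZ.
  exists k => y; pose L' : set M :=
    [set x | exists2 z, z \in L & exists y, x = a ^+ k *: y + z].
  have memL' x : x \in span L' <-> L' x.
    apply: mem_span_closed => [|b _ _ [u uL [y1 ->]] [v vL [y2 ->]]].
      by exists 0; rewrite ?rpred0 //; exists 0; rewrite scaler0 addr0.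
    exists (b *: u + v); first exact: submod_lin.
    by exists (b *: y1 + y2); rewrite !scalerDr !scalerA [b * _]mulrC addrACA.
  apply: (maxL (span L')) => [x xL|x /memL'[z zL [t xE]] xK|].
  - by apply/memL'; exists x => //; exists 0; rewrite scaler0 add0r.
  - (* [a^(n + k) t] is [a^n x - a^n z], and [a^n x] lies in [I^n K]. *)
    apply: LKT => //; rewrite xE rpredD //.
    apply/memQ/(kP (n + k)%N)/memQ; rewrite /Q /= exprD -scalerA.
    have -> : a ^+ k *: t = x - z by rewrite xE addrK.
    rewrite scalerBr; apply: submod_subr; last exact: rpredZ.
    apply: TL; apply: mem_span; exists (a ^+ n); last by exists x.
    exact: exp_in_ideal_pow.
  by apply/memL'; exists 0; rewrite ?rpred0 //; exists y; rewrite addr0.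
have [s Is] := noethA I.
have [k sk] : exists k, forall a, a \in s -> forall y, a ^+ k *: y \in L.
  have {Is} : forall a, a \in s -> (a : A^o) \in I.
    by move=> a sa; rewrite Is; exact: mem_span.
  elim: s => [|a s IH] sI; first by exists 0.
  have [b bs|k kP] := IH; first by apply: sI; rewrite inE bs orbT.
  have [|l lP] := powL a; first by apply: sI; exact: mem_head.
  exists (k + l)%N => b; rewrite inE => /orP[/eqP ->|bs] y.
    by rewrite exprD -scalerA rpredZ.
  by rewrite exprD mulrC -scalerA; apply: rpredZ; exact: kP.
pose J : set A^o := [set a : A^o | forall y : M, (a : A) *: y \in L].
have memJ a : a \in span J <-> J a.
  apply: (mem_span_closed (M := A^o) (P := J)) => [y|b u v uL vL y].
    by rewrite scale0r rpred0.
  by rewrite -[b *: u + v]/(b * u + v) scalerDl -scalerA; exact: submod_lin.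
have [N NP] : exists N, forall x, x \in ideal_pow I N -> x \in span J.
  by apply: (ideal_pow_sub Is) => a sa; apply/memJ; exact: sk.
exists N => x xK xN; apply: LKT => //; move: x xN {xK}.
by apply: span_sub => _ [a aN [y _ <-]]; move/NP/memJ: aN; exact.
Qed.

End IdealPowers.

(** * Factoring decaying families through a submodule *)

Section Factorization.
Variables (A : comPzRingType) (I : submodClosed A^o).
Hypothesis noethA : noetherian A.

Lemma ideal_act_span_seq (M : lmodType A) (J : submodClosed A^o) (s : seq M) x :
  x \in ideal_act J (span [set` s]) ->
  exists2 c : 'I_(size s) -> A, (forall i, (c i : A^o) \in J) &
    x = \sum_i c i *: s`_i.
Proof.
move: x; apply: span_ind => [|a u v [c cJ ->] [d dJ ->]|_ [a aJ [y ys <-]]].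
- exists (fun=> 0); first by move=> i; rewrite rpred0.
  by rewrite big1 // => i _; rewrite scale0r.
- exists (fun i => a * c i + d i).
    by move=> i; apply: rpredD => //; exact: ideal_mull.
  rewrite scaler_sumr -big_split /=.
  by apply: eq_bigr => i _; rewrite scalerDl scalerA.
have [c ->] := mem_span_seq ys; exists (fun i => a * c i).
  by move=> i; rewrite mulrC; exact: ideal_mull.
by rewrite scaler_sumr; apply: eq_bigr => i _; rewrite scalerA.
Qed.

Definition unit_vector r (i : 'I_r) : 'I_r -> A^o := fun j => (i == j)%:R.

Lemma sum_unit_vectors r (x : 'I_r -> A^o) : x = \sum_i x i *: unit_vector i.
Proof.
apply/funext => j; rewrite fct_sumE (bigD1 j) //= big1 => [|i /negbTE ij].
  by rewrite addr0 -[RHS]/(x j * unit_vector j j) /unit_vector eqxx mulr1.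
by rewrite -[LHS]/(x i * unit_vector i j) /unit_vector ij mulr0.
Qed.

Lemma noetherian_free r : noetherian_module ('I_r -> A^o).
Proof.
move=> N; apply: (@fg_of_noetherian _ _ [seq unit_vector i | i <- enum 'I_r]) => //.
move=> x _; rewrite (sum_unit_vectors x); apply: rpred_sum => i _.
by apply: rpredZ; apply: mem_span => /=; rewrite map_f ?mem_enum.
Qed.

Hypothesis separated :
  forall a : A, (forall n, (a : A^o) \in ideal_pow I n) -> a = 0.

(** For each [n] separately, the Artin-Rees lemma gives coefficients of [x] in
    [I^n] as soon as [x] has entries in [I^(N n)]. A single choice serves all [n]
    at once: the one made for the largest [n] with entries of [x] in [I^(N n)],
    or zero if these [n] are unbounded, since then [x = 0] by separatedness. *)
Lemma uniform_small_coefs r (K : submodClosed ('I_r -> A^o)) :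
  exists s (b : 'I_s -> 'I_r -> A^o) (N : nat -> nat), (forall l, b l \in K) /\
    forall x, x \in K -> exists2 g : 'I_s -> A, x = \sum_l g l *: b l &
      forall n, (forall j, x j \in ideal_pow I (N n)) ->
        forall l, (g l : A^o) \in ideal_pow I n.
Proof.
have noethF := @noetherian_free r.
have [s sK] := noethF K.
have /choice[N NP] : forall n, exists N, (n <= N)%N /\ forall x, x \in K ->
    (forall j, x j \in ideal_pow I N) ->
    exists2 g : 'I_(size s) -> A, (forall l, (g l : A^o) \in ideal_pow I n) &
      x = \sum_l g l *: s`_l.
  move=> n; have [N NP] := artin_rees I K n noethA noethF.
  (* [n <= N n] is what makes [x] vanish when the allowed [n] are unbounded. *)
  exists (maxn n N); split; first exact: leq_maxl.
  move=> x xK xN; apply: ideal_act_span_seq.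
  have : x \in ideal_act (ideal_pow I n) K.
    apply: NP => //; rewrite (sum_unit_vectors x); apply: rpred_sum => j _.
    apply: mem_span; exists (x j); last first.
      by exists (unit_vector j) => //; exact: mem_span.
    exact: ideal_pow_le (leq_maxr n N) (xN j).
  move: x {xK xN}; apply: span_sub => _ [a aI [y yK <-]].
  by apply: mem_span; exists a => //; exists y => //; rewrite /= -sK.
exists (size s), (fun l => s`_l), N; split=> [l|x xK].
  by rewrite sK; apply: mem_span => /=; exact: mem_nth.
pose P n := forall j, x j \in ideal_pow I (N n).
have upto n0 : exists2 g : 'I_(size s) -> A, x = \sum_l g l *: s`_l &
    forall n, (n < n0)%N -> P n -> forall l, (g l : A^o) \in ideal_pow I n.
  elim: n0 => [|n0 [g xg gI]].
    by have := xK; rewrite sK => /mem_span_seq[g xg]; exists g.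
  have [Pn0|nP] := pselect (P n0).
    have [h hI xh] := (NP n0).2 x xK Pn0; exists h => // n nn0 _ l.
    exact: ideal_pow_le (hI l).
  exists g => // n; rewrite ltnS leq_eqVlt => /orP[/eqP -> //|]; exact: gI.
have [[n0 Pn0]|unb] := pselect (exists n0, forall n, P n -> (n < n0)%N).
  by have [g xg gI] := upto n0; exists g => // n Pn; apply: gI => //; exact: Pn0.
have x0 : x = 0.
  apply/funext => j; apply: separated => n.
  have /existsNP[m /not_implyP[Pm /negP]] : ~ forall m, P m -> (m < n)%N.
    by move=> Pn; apply: unb; exists n.
  rewrite -leqNgt => nm; apply: ideal_pow_le (Pm j).
  exact: leq_trans nm (NP m).1.
exists (fun=> 0); first by rewrite x0 big1 // => l _; rewrite scale0r.
by move=> n _ l; rewrite rpred0.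
Qed.

Variable Z : Type.
Implicit Type f : Fdec I Z.

Lemma fdec_finite f n : finite_set [set z | f z \notin ideal_pow I n].
Proof.
case: n => [|n].
  rewrite (_ : [set _ | _] = set0) //; apply/seteqP; split=> z //=.
  by rewrite mem_span.
have /asboolP/(_ n) := fdec_valP f; apply: sub_finite_set => z /= fz.
exact/ord_le.
Qed.

Lemma decaying_intro (h : Z -> A^o) :
  (forall n, finite_set [set z | h z \notin ideal_pow I n]) ->
  h \in decaying I (Z := Z).
Proof.
move=> finh; apply/asboolP => i; apply: sub_finite_set (finh i.+1) => z /=.
by move/ord_le.
Qed.

Lemma sum_fdecE s (F : 'I_s -> Fdec I Z) z : (\sum_i F i) z = \sum_i F i z.
Proof. exact: (big_morph (fun h : Fdec I Z => h z)). Qed.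

(** Working pointwise suffices: the coefficients found at each [z] form decaying
    functions, because they are in [I^n] wherever the [f j] are all in [I^(N n)],
    hence outside a finite set. *)
Lemma fdec_factor r (K : submodClosed ('I_r -> A^o)) (f : 'I_r -> Fdec I Z) :
  (forall z, (fun j => f j z) \in K) ->
  exists s (b : 'I_s -> 'I_r -> A^o) (g : 'I_s -> Fdec I Z),
    (forall l, b l \in K) /\ forall j, f j = \sum_l (b l j : A) *: g l.
Proof.
move=> fK; have [s [b [N [bK coefs]]]] := uniform_small_coefs K.
have /choice[g gP] : forall z, exists g : 'I_s -> A,
    (fun j => f j z) = \sum_l g l *: b l /\
    forall n, (forall j, f j z \in ideal_pow I (N n)) ->
      forall l, (g l : A^o) \in ideal_pow I n.
  by move=> z; have [g fg gI] := coefs _ (fK z); exists g.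
have gdec l : (fun z => g z l : A^o) \in decaying I (Z := Z).
  apply: decaying_intro => n.
  apply: (@sub_finite_set _ _
    (\bigcup_(j in [set: 'I_r]) [set z | f j z \notin ideal_pow I (N n)])).
    move=> z /= gz; apply: contrapT => nfz; move/negP: gz; apply.
    apply: (gP z).2 => j; apply: contrapT => /negP fz; apply: nfz.
    by exists j.
  by apply: bigcup_finite => // j _; exact: fdec_finite.
exists s, b, (fun l => MkFdec (gdec l)); split=> // j.
apply/val_inj/funext => z; rewrite /= -[RHS]/((\sum_l (b l j : A) *: MkFdec (gdec l)) z).
rewrite sum_fdecE -[LHS]/((fun j => f j z) j) (gP z).1 fct_sumE.
by apply: eq_bigr => l _; exact: mulrC.
Qed.

(** Injectivity of the evaluation map from the tensor product of [Fdec I Z] and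
    [M] to [Z -> M], for every [M]; an arbitrary bilinear map replaces the tensor
    product, so that its factors may come in either order. The relations between
    the [m j] form a submodule of [A^r] to which all the values of [f] belong, so
    [f] is a combination of decaying functions with such relations as
    coefficients, and [beta] kills each term. *)
Lemma bilinear_fdec_eq0 (M P : lmodType A) (beta : Fdec I Z -> M -> P) r
    (f : 'I_r -> Fdec I Z) (m : 'I_r -> M) : is_bilinear beta ->
  (forall z, \sum_j (f j z : A) *: m j = 0) -> \sum_j beta (f j) (m j) = 0.
Proof.
case=> betal betar rel.
pose K : set ('I_r -> A^o) := [set c | \sum_j (c j : A) *: m j = 0].
have memK c : c \in span K <-> K c.
  apply: (mem_span_closed (M := 'I_r -> A^o) (P := K)) => [|a u v uK vK].
    by rewrite /K /= big1 // => j _; exact: scale0r.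
  rewrite /K /=.
  rewrite (eq_bigr (fun j => a *: ((u j : A) *: m j) + (v j : A) *: m j)) => [|j _].
    by rewrite big_split /= -scaler_sumr uK vK scaler0 addr0.
  by rewrite -[(a *: u + v) j]/((a * u j + v j) : A) scalerDl scalerA.
have [|s [b [g [bK fE]]]] := @fdec_factor r (span K) f.
  by move=> z; apply/memK; exact: rel.
under eq_bigr => j _ do rewrite fE (linear_fun_comb (h := beta^~ (m j))) //.
rewrite exchange_big big1 //= => l _.
rewrite -(linear_fun_comb (h := beta (g l))) //.
move/memK: (bK l); rewrite /K /= => ->.
exact: linear_fun0.
Qed.

End Factorization.

(** * Tensors as finite sums of pure tensors *)

Section TensorSums.
Variables (A : comPzRingType) (M N : lmodType A).

Lemma tfree_expand (f : tfree M N) : exists s : seq (M * N),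
  f = \sum_(x <- s) (f x : A) *: tbasis x.1 x.2.
Proof.
have /asboolP finf := ffin_valP f.
exists (fset_set [set x | f x != 0]).
apply/val_inj/funext => y; set s := fset_set _.
rewrite -[RHS]/((\sum_(x <- s) (f x : A) *: tbasis x.1 x.2) y).
rewrite (big_morph (fun h : tfree M N => h y) (id1 := 0) (op1 := +%R)) //.
have termE x : ((f x : A) *: tbasis x.1 x.2 : tfree M N) y = f x * (y == x)%:R.
  by case: x.
under eq_bigr do rewrite termE.
have [ys|ys] := boolP (y \in s).
  rewrite (bigD1_seq y) ?fset_uniq // eqxx mulr1 big1 => [|x /negbTE].
    exact/esym/addr0.
  by rewrite eq_sym => ->; rewrite mulr0.
rewrite big_seq big1 => [|x xs].
  apply/eqP; apply: contraNT ys => fy; rewrite in_fset_set //.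
  exact/mem_set.
have [yx|_] := eqVneq y x; last exact: mulr0.
by rewrite yx xs in ys.
Qed.

Lemma tensor_sum_tpure (t : tensor M N) :
  exists r (m : 'I_r -> M) (n : 'I_r -> N), t = \sum_j tpure (m j) (n j).
Proof.
have [f tE] : exists f : tfree M N, t = qpi (span (@trelator A M N)) f.
  by exists (repr (t : quotmod _)); rewrite qpi_repr.
have [s fE] := tfree_expand f.
exists (size s), (fun j => (f (nth (0, 0) s j) : A) *: (nth (0, 0) s j).1),
  (fun j => (nth (0, 0) s j).2).
rewrite tE [X in qpi _ X]fE (big_nth (0, 0)) big_mkord.
rewrite (linear_fun_comb (@qpi_is_linear _ _ _)).
by apply: eq_bigr => j _; rewrite tpureZl.
Qed.

Lemma tensor_lift_sum (P : lmodType A) (b : M -> N -> P) r (m : 'I_r -> M)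
    (n : 'I_r -> N) : is_bilinear b ->
  tensor_lift b (\sum_j tpure (m j) (n j)) = \sum_j b (m j) (n j).
Proof.
move=> bil; rewrite (linear_fun_sum (tensor_lift_is_linear bil)).
by apply: eq_bigr => j _; rewrite tensor_lift_pure.
Qed.

Lemma tpure_bilinear : is_bilinear (@tpure A M N).
Proof.
split=> [n a x y|m a x y]; first by rewrite tpureDl tpureZl.
by rewrite tpureDr tpureZr.
Qed.

End TensorSums.

Lemma bilinear_flip (A : comPzRingType) (M N P : lmodType A) (b : M -> N -> P) :
  is_bilinear b -> is_bilinear (fun n m => b m n).
Proof. by case. Qed.

Lemma bijective_of_inj_surj (T U : Type) (f : T -> U) :
  injective f -> (forall u, exists t, f t = u) -> bijective f.
Proof.
move=> injf surjf; rewrite -setTT_bijective; split=> //.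
  by move=> x y _ _; exact: injf.
by move=> u _; have [t tu] := surjf u; exists t.
Qed.

(** * The adic limit *)

Section AdicLimit.
Variables (A : comPzRingType) (I : submodClosed A^o) (M : lmodType A).

Lemma adic_lim_eq (p q : adic_lim I M) : (forall i, sval p i = sval q i) -> p = q.
Proof.
case: p q => [p pc] [q qc] /= pq.
have {}pq : p = q by exact: functional_extensionality_dep.
by case: q / pq qc => qc; congr exist; exact: Prop_irrelevance.
Qed.

(** Completeness in terms of sequences in [M], which removes the quotients and
    their inverse limit from all later arguments. *)
Lemma adically_completeP : adically_complete I M <->
  (forall x : M,
     (forall i, x \in ideal_act (ideal_pow I i.+1) (full_submod M)) -> x = 0) /\
  (forall x : nat -> M,
     (forall i j, (i <= j)%N ->
        x j - x i \in ideal_act (ideal_pow I i.+1) (full_submod M)) ->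
     exists y, forall i, y - x i \in ideal_act (ideal_pow I i.+1) (full_submod M)).
Proof.
split=> [[inv toK invK]|[sep lims]].
  split=> [x xI|x xC].
    apply: (can_inj toK); apply: adic_lim_eq => i; apply/qpi_eq.
    by rewrite subr0.
  have qC : adic_compat (fun i => adic_pi I i (x i)).
    by move=> i j ij; rewrite adic_trans_pi //; apply/qpi_eq; exact: xC.
  exists (inv (exist _ _ qC)) => i; apply/qpi_eq.
  by have := congr1 (fun q : adic_lim I M => sval q i) (invK (exist _ _ qC)).
apply: bijective_of_inj_surj => [x y xy|[q qC]].
  apply/eqP; rewrite -subr_eq0; apply/eqP/sep => i; apply/qpi_eq.
  by have := congr1 (fun q : adic_lim I M => sval q i) xy.
have [|y yP] := lims (fun i => repr (q i : quotmod _)).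
  move=> i j ij; apply/qpi_eq; rewrite qpi_repr; exact: qC.
by exists y; apply: adic_lim_eq => i; rewrite /= -[RHS]qpi_repr; apply/qpi_eq.
Qed.

End AdicLimit.

(** * Decaying functions *)

Section DecayingFunctions.
Variables (A : comPzRingType) (I : submodClosed A^o) (Z : Type).
Hypotheses (noethA : noetherian A) (complA : adically_complete I A^o).

Lemma complete_separated (a : A) :
  (forall n, (a : A^o) \in ideal_pow I n) -> a = 0.
Proof.
move=> aI; have [sep _] := (adically_completeP I A^o).1 complA.
by apply: sep => i; apply/ideal_act_full.
Qed.

(** A decaying function with values in [I^n] factors, as a family of length one,
    through the submodule [I^n] of [A]: it is a finite combination of decaying
    functions with coefficients in [I^n]. *)
Lemma mem_ideal_act_fdec n (f : Fdec I Z) :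
  f \in ideal_act (ideal_pow I n) (full_submod (Fdec I Z)) <->
  forall z, f z \in ideal_pow I n.
Proof.
split=> [fI z|fI].
  move: f fI; apply: span_ind => [|a u v uI vI|_ [a aI [g _ <-]]].
  - by rewrite -[X in X \in _]/(0 : A^o) rpred0.
  - by rewrite -[X in X \in _]/(a *: u z + v z) submod_lin.
  by rewrite -[X in X \in _]/(a * g z) mulrC; exact: ideal_mull.
pose K : set ('I_1 -> A^o) := [set c | c ord0 \in ideal_pow I n].
have memK c : c \in span K <-> K c.
  apply: (mem_span_closed (M := 'I_1 -> A^o) (P := K)) => [|a u v uK vK].
    by rewrite /K /= -[X in X \in _]/(0 : A^o) rpred0.
  by rewrite /K /= -[X in X \in _]/(a *: u ord0 + v ord0) submod_lin.
have [|s [b [g [bK fE]]]] := fdec_factor noethA complete_separated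
    (K := span K) (f := fun=> f).
  by move=> z; apply/memK; exact: fI.
rewrite (fE ord0); apply: rpred_sum => l _; apply: mem_span.
exists (b l ord0); last by exists (g l) => //; exact: mem_span.
exact/memK/bK.
Qed.

(** Limits are taken pointwise. The limit agrees modulo [I^n] with one of the
    approximating functions, so it decays. *)
Lemma fdec_complete : adically_complete I (Fdec I Z).
Proof.
apply/adically_completeP; split=> [f fI|f fC].
  apply/val_inj/funext => z; apply: complete_separated => n.
  by apply: ideal_powS; apply: (mem_ideal_act_fdec n.+1 f).1; exact: fI.
have [_ lims] := (adically_completeP I A^o).1 complA.
have /choice[h hP] : forall z, exists y : A^o, forall i,
    y - f i z \in ideal_pow I i.+1.
  move=> z; have [|y yP] := lims (fun i => f i z).
    move=> i j ij; apply/ideal_act_full.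
    exact: ((mem_ideal_act_fdec i.+1 _).1 (fC i j ij) z).
  by exists y => i; apply/ideal_act_full.
have hdec : h \in decaying I (Z := Z).
  apply: decaying_intro => n; apply: sub_finite_set (fdec_finite (f n) n) => z /=.
  apply: contra => fn; rewrite -(subrK (f n z) (h z)) rpredD //.
  exact: ideal_powS.
by exists (MkFdec hdec) => i; apply/mem_ideal_act_fdec => z; exact: hP.
Qed.

(** A tensor in the kernel of the map induced by an injective [g] evaluates to [0]
    in [Z -> N2], hence in [Z -> N1], and evaluation there is injective. *)
Lemma fdec_flat : flat (Fdec I Z).
Proof.
move=> N1 N2 g injg s t st; apply/eqP; rewrite -subr_eq0; apply/eqP.
have : tensor_mapr g (s - t) = 0 by rewrite linearB /= st subrr.
have [r [f [n ->]]] := tensor_sum_tpure (s - t).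
rewrite /= /tensor_mapr (tensor_lift_sum _ _ (tensor_mapr_bilinear (Fdec I Z) g)) => gu0.
apply: (bilinear_fdec_eq0 noethA complete_separated); first exact: tpure_bilinear.
move=> z; apply: injg; rewrite linear0.
pose ev (h : Fdec I Z) (m : N2) : Z -> N2 := fun y => (h y : A) *: m.
have evbil : is_bilinear ev.
  split=> [m a u v|h a m m']; apply/funext => y.
    rewrite -[LHS]/((a * u y + v y) *: m) scalerDl -scalerA.
    by [].
  rewrite -[LHS]/((h y : A) *: (a *: m + m')) scalerDr scalerA mulrC -scalerA.
  by [].
have := congr1 (tensor_lift ev) gu0.
rewrite (tensor_lift_sum _ _ evbil) (linear_fun0 (tensor_lift_is_linear evbil)).
move/(congr1 (fun k => k z)); rewrite fct_sumE linear_sum => ev0.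
apply: etrans ev0; by apply: eq_bigr => j _; rewrite linearZ.
Qed.

(** Up to the order of the factors and the inclusion into all functions,
    [dec_to_fin] is the evaluation map for the module [A / I^(i+1)]. *)
Lemma dec_to_fin_injective i : injective (@dec_to_fin A I Z i).
Proof.
move=> s t st; apply/eqP; rewrite -subr_eq0; apply/eqP.
have : dec_to_fin (s - t) = 0 by rewrite linearB /= st subrr.
have [r [a [f ->]]] := tensor_sum_tpure (s - t).
rewrite /= /dec_to_fin (tensor_lift_sum _ _ (@dec_to_fin_bilinear A I Z i)) => u0.
pose beta (h : Fdec I Z) (c : adic_ring I i) := tpure c h.
rewrite -[LHS]/(\sum_j beta (f j) (a j)).
apply: (bilinear_fdec_eq0 noethA complete_separated).
  exact/bilinear_flip/tpure_bilinear.
move=> z; have := congr1 (fun k : Ffin Z (adic_ring I i) => k z) u0.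
rewrite (big_morph (fun k : Ffin Z (adic_ring I i) => k z) (id1 := 0) (op1 := +%R)) //.
move=> ev0; apply: etrans ev0; apply: eq_bigr => j _.
by rewrite /= mulrC -rpiZ.
Qed.

Lemma dec_to_fin_surjective i (h : Ffin Z (adic_ring I i)) :
  exists t, dec_to_fin t = h.
Proof.
(* [repr 0] may be a nonzero element of [I^(i+1)]; without the test, [f] might
   not decay. *)
pose f z : A^o := if h z == 0 then 0 else repr (h z : quotmod _).
have fdec : f \in decaying I (Z := Z).
  have /asboolP finh := ffin_valP h.
  apply: decaying_intro => n; apply: sub_finite_set finh => z /=.
  by apply: contraNneq => hz0; rewrite /f hz0 eqxx rpred0.
exists (tpure (1 : adic_ring I i) (MkFdec fdec)); apply/val_inj/funext => z.
rewrite /= dec_to_fin_pure mul1r /= /f.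
have [->|_] := eqVneq; last exact: rpi_repr.
exact: (linear0 (qpi (ideal_pow I i.+1))).
Qed.

End DecayingFunctions.

Theorem theorem3p4 (A : comPzRingType) (I : submodClosed A^o) (Z : Type)
    (noethA : noetherian A) (complA : adically_complete I A^o) :
  (forall i : nat,
     bijective (dec_to_fin (I := I) (Z := Z) (i := i) :
       tensor (adic_ring I i) (Fdec I Z) -> Ffin Z (adic_ring I i))) /\
  (flat (Fdec I Z) /\ adically_complete I (Fdec I Z)).
Proof.
split=> [i|].
  apply: bijective_of_inj_surj; first exact: dec_to_fin_injective.
  exact: dec_to_fin_surjective.
split; first exact: fdec_flat.
exact: fdec_complete.
Qed.
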